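(* Let $A=(a_{ij})$ be an $n\times n$ matrix whose entries are non-negative integers, with $\det(A)=\pm1$. Let $\vec v=(v_1,\ldots,v_n)^t$ be a column vector whose coefficients are positive, rationally independent real numbers, and suppose that all coefficients of $\vec w=A^{-1}\vec v$ are positive (so that $(A,\vec v,\vec w)$ is an $n$-dimensional triple). Then there exists a finite sequence of permissible column additions and row interchanges $$(A,\vec v,\vec w)\rightarrow (A(1),\vec v(1),\vec w(1))\rightarrow\cdots\rightarrow (A(s),\vec v(s),\vec w(s))$$ followed by a finite sequence of permissible row subtractions $$(A(s),\vec v(s),\vec w(s))\rightarrow (A(s+1),\vec v(s+1),\vec w(s))\rightarrow\cdots\rightarrow (A(t),\vec v(t),\vec w(t))$$ such that $A(t)$ is the $n\times n$ identity matrix.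
   Context: An $n$-dimensional triple $(A,\vec v,\vec w)$ consists of: an $n\times n$ matrix $A=(a_{ij})$ with non-negative integer entries and $\det(A)=\pm1$; a column vector $\vec v=(v_1,\ldots,v_n)^t$ of positive real numbers that are rationally independent (linearly independent over $\mathbf Q$); and the vector $\vec w=(w_1,\ldots,w_n)^t=A^{-1}\vec v$, which is required to have all coefficients positive. Operations on a triple (with $i\neq j$): Column addition $C_{ij}$: adds the $j$-th column of $A$ to the $i$-th column. It is permissible for $(A,\vec v,\vec w)$ if $w_j-w_i>0$. It transforms the triple into $(A(1),\vec v(1),\vec w(1))$, where $A(1)$ is the new matrix, $\vec v(1)=\vec v$, and $\vec w(1)=A(1)^{-1}\vec v(1)$ (i.e. $w_j$ is replaced by $w_j-w_i$ and the other coefficients of $\vec w$ are unchanged). Row subtraction $R_{ji}$: subtracts the $i$-th row of $A$ from the $j$-th row. It is permissible for $(A,\vec v,\vec w)$ if $a_{jk}\ge a_{ik}$ for $1\le k\le n$. It transforms the triple into $(A(1),\vec v(1),\vec w(1))$, where $A(1)$ is the new matrix, $\vec v(1)$ is obtained from $\vec v$ by replacing $v_j$ by $v_j-v_i$, and $\vec w(1)=A(1)^{-1}\vec v(1)=\vec w$. Row interchange $T_{ij}$: interchanges the $i$-th and $j$-th rows of $A$ and the $i$-th and $j$-th coefficients of $\vec v$, and leaves $\vec w$ unchanged. Row interchanges are always allowed. *)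

(* Defs.v *)
From HB Require Import structures.
From mathcomp Require Import all_boot all_order all_algebra.
From mathcomp Require Import reals.

Set Implicit Arguments.
Unset Strict Implicit.
Unset Printing Implicit Defensive.

Import Order.TTheory GRing.Theory Num.Theory.
Local Open Scope ring_scope.

Definition rat_independent (R : realType) (n : nat) (v : 'cV[R]_n) : Prop :=
  forall c : 'I_n -> rat, \sum_i ratr (c i) * v i 0 = 0 -> forall i, c i = 0.

(* The inverse is taken after mapping [A] to real entries. *)
Definition inv_apply (R : realType) (n : nat) (A : 'M[int]_n) (v : 'cV[R]_n) :
    'cV[R]_n :=
  invmx (map_mx intr A) *m v.

Record triple (R : realType) (n : nat) := Triple {
  tA : 'M[int]_n;
  tv : 'cV[R]_n;
  tw : 'cV[R]_n;
  tA_ge0 : forall i j, 0 <= tA i j;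
  tA_det : \det tA = 1 \/ \det tA = -1;
  tv_gt0 : forall i, 0 < tv i 0;
  tv_indep : rat_independent tv;
  tw_def : tw = inv_apply tA tv;
  tw_gt0 : forall i, 0 < tw i 0
}.

Definition add_col (n : nat) (i j : 'I_n) (A : 'M[int]_n) : 'M[int]_n :=
  \matrix_(k, l) (if l == i then A k i + A k j else A k l).

Definition sub_row (S : zmodType) (m n : nat) (j i : 'I_m) (M : 'M[S]_(m, n)) :
    'M[S]_(m, n) :=
  \matrix_(k, l) (if k == j then M j l - M i l else M k l).

(* The new [w] is determined by the field [tw_def] of [T']. *)
Definition column_addition (R : realType) (n : nat) (i j : 'I_n)
    (T T' : triple R n) : Prop :=
  [/\ i != j, 0 < tw T j 0 - tw T i 0,
      tA T' = add_col i j (tA T) & tv T' = tv T].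

Definition row_subtraction (R : realType) (n : nat) (j i : 'I_n)
    (T T' : triple R n) : Prop :=
  [/\ i != j, forall k, tA T i k <= tA T j k,
      tA T' = sub_row j i (tA T), tv T' = sub_row j i (tv T) & tw T' = tw T].

Definition row_interchange (R : realType) (n : nat) (i j : 'I_n)
    (T T' : triple R n) : Prop :=
  [/\ i != j, tA T' = xrow i j (tA T), tv T' = xrow i j (tv T) & tw T' = tw T].

(* Main.v *)
(* The proof is by induction on [n].  Fix a unit vector [e_r] and let [c] be the
   integer vector with [A c = e_r].  The addition [C_ij] of column [j] to column
   [i] acts on [c] and on [w] in the same way: it subtracts entry [i] from entry
   [j], and it is permissible iff [w_i < w_j].  If [n >= 3], two of the entries
   of [c] have the same sign, and subtracting one from the other, in the order
   dictated by [w], never increases [max |c_k|]; as the entries of [c] are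
   coprime, this can be continued until [c] has entries in [{-1, 0, 1}], and then
   until [c = e_p - e_q], that is, until column [p] is [e_r] plus column [q].

   After a row interchange [r = p].  Deleting row and column [p], and replacing
   [w_q] by [w_q + w_p], gives an [(n-1)]-dimensional triple.  Every column
   addition or row interchange on it lifts to the big triple while keeping a
   relation "column [p] = [e_p] + column [q']" for some [q'], so the induction
   hypothesis applies.  Once the small matrix can be reduced to the identity by
   row subtractions, so can the big one. *)

Require Import Defs.
From HB Require Import structures.
From Stdlib Require Import Relation_Operators Operators_Properties.
From mathcomp Require Import all_boot all_order all_algebra.
From mathcomp Require Import perm reals.
From mathcomp Require Import zify ring lra.

Set Implicit Arguments.
Unset Strict Implicit.
Unset Printing Implicit Defensive.

Import Order.TTheory GRing.Theory Num.Theory.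
Local Open Scope ring_scope.

(** * Elementary operations on triples *)

Section Triples.
Variables (R : realType) (n : nat).
Implicit Types (A : 'M[int]_n) (v w : 'cV[R]_n) (T : triple R n).

Lemma add_colE (i j : 'I_n) A : add_col i j A = A *m (1%:M + delta_mx j i).
Proof.
apply/matrixP => k l; rewrite mulmxDr mulmx1 !mxE.
rewrite (bigD1 j) //= big1 => [|m /negbTE mj]; last by rewrite mxE mj mulr0.
rewrite !mxE eqxx addr0 /=.
by case: eqP => [->|_]; rewrite ?mulr1 ?mulr0 ?addr0.
Qed.

Lemma sub_rowE (S : pzRingType) m (j i : 'I_n) (X : 'M[S]_(n, m)) :
  sub_row j i X = (1%:M - delta_mx j i) *m X.
Proof.
apply/matrixP => k l; rewrite mulmxBl mul1mx !mxE.
rewrite (bigD1 i) //= big1 => [|t /negbTE ti].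
  rewrite !mxE eqxx andbT addr0.
  by case: eqP => [->|_]; rewrite ?mul1r ?mul0r ?subr0.
by rewrite mxE ti andbF mul0r.
Qed.

Lemma mul_elementary (S : pzRingType) (i j : 'I_n) : i != j ->
  (1%:M + delta_mx j i) *m (1%:M - delta_mx j i) = 1%:M :> 'M[S]_n.
Proof.
move=> ij; rewrite mulmxDl mul1mx mulmxBr mulmx1 mul_delta_mx_cond.
by rewrite (negbTE ij) mulr0n subr0 subrK.
Qed.

(** The two elementary matrices are inverse to each other. Used over the reals for the weights [w]
    and over the integers for coordinate vectors [c]. *)
Lemma mul_add_col_sub_row (S : pzRingType) (f : {rmorphism int -> S}) m
    (i j : 'I_n) A (X : 'M[S]_(n, m)) : i != j ->
  map_mx f (add_col i j A) *m sub_row j i X = map_mx f A *m X.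
Proof.
move=> ij; rewrite add_colE sub_rowE map_mxM map_mxD map_mx1 map_delta_mx.
by rewrite -mulmxA [in X in _ *m X]mulmxA mul_elementary // mul1mx.
Qed.

Lemma det_unitmx A : (\det A = 1 \/ \det A = -1) <-> A \in unitmx.
Proof.
rewrite unitmxE; split=> [[]->|]; rewrite ?unitrN ?unitr1 //.
by rewrite qualifE /= => /orP[]/eqP; [left|right].
Qed.

Lemma add_col_unitmx i j A : i != j -> A \in unitmx -> add_col i j A \in unitmx.
Proof.
move=> ij uA; rewrite add_colE unitmx_mul uA /=.
by have [] := mulmx1_unit (mul_elementary int ij).
Qed.

Lemma sub_row_unitmx i j A : i != j -> A \in unitmx -> sub_row j i A \in unitmx.
Proof.
move=> ij uA; rewrite sub_rowE unitmx_mul uA andbT.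
by have [] := mulmx1_unit (mul_elementary int ij).
Qed.

Lemma tA_unitmx T : tA T \in unitmx.
Proof. by apply/det_unitmx; apply: tA_det. Qed.

Lemma map_intr_unitmx A : A \in unitmx -> map_mx (intr : int -> R) A \in unitmx.
Proof. by move=> uA; rewrite unitmxE det_map_mx rmorph_unit. Qed.

Lemma triple_intro A v w :
    (forall i j, 0 <= A i j) -> A \in unitmx ->
    (forall i, 0 < v i 0) -> rat_independent v ->
    map_mx intr A *m w = v -> (forall i, 0 < w i 0) ->
  exists T, [/\ tA T = A, tv T = v & tw T = w].
Proof.
move=> A0 dA v0 iv Aw w0.
have wE : w = inv_apply A v by rewrite /inv_apply -Aw mulKmx // map_intr_unitmx.
by exists (Triple A0 (proj2 (det_unitmx A) dA) v0 iv wE w0).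
Qed.

Lemma mul_tA_tw T : map_mx intr (tA T) *m tw T = tv T.
Proof. by rewrite (tw_def T) mulKVmx // map_intr_unitmx // tA_unitmx. Qed.

Lemma rat_independent_int v (c : 'I_n -> int) : rat_independent v ->
  \sum_i (c i)%:~R * v i 0 = 0 -> forall i, c i = 0.
Proof.
move=> iv cv i; apply/eqP; rewrite -(intr_eq0 rat); apply/eqP.
apply: (iv (fun i => (c i)%:~R)).
by rewrite -[RHS]cv; apply: eq_bigr => j _; rewrite ratr_int.
Qed.

(** A tie would be an integer relation with coefficients [1] and [-1]. This makes [v_j - v_i]
    strictly positive in a permissible row subtraction. *)
Lemma tv_neq T i j : i != j -> tv T i 0 != tv T j 0.
Proof.
move=> ij; apply/eqP => vij.
pose c (k : 'I_n) : int := (k == i)%:Z - (k == j)%:Z.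
have /(rat_independent_int (@tv_indep _ _ T)) : \sum_k (c k)%:~R * tv T k 0 = 0.
  transitivity (\sum_k ((k == i)%:R * tv T k 0 - (k == j)%:R * tv T k 0)).
    by apply: eq_bigr => k _; rewrite /c rmorphB /= mulrBl.
  rewrite sumrB (bigD1 i) //= eqxx big1 => [|k /negbTE->]; last by rewrite mul0r.
  rewrite (bigD1 j) //= eqxx big1 => [|k /negbTE->]; last by rewrite mul0r.
  by rewrite vij subrr.
move=> /(_ i); rewrite /c eqxx (negbTE ij) /=; lia.
Qed.

(** The inverse of [tA T] is an integer matrix, so a tie would be an integer relation on [v] and
    would force its rows [i] and [j] to coincide. Hence one of the two additions between columns [i]
    and [j] is always permissible. *)
Lemma tw_neq T i j : i != j -> tw T i 0 != tw T j 0.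
Proof.
move=> ij; apply/eqP => wij.
pose B := invmx (tA T).
have wE : tw T = map_mx intr B *m tv T.
  by rewrite -mul_tA_tw mulmxA -map_mxM mulVmx ?tA_unitmx // map_mx1 mul1mx.
have /(rat_independent_int (@tv_indep _ _ T)) : \sum_k (B i k - B j k)%:~R * tv T k 0 = 0.
  transitivity (tw T i 0 - tw T j 0); last by rewrite wij subrr.
  rewrite wE !mxE -sumrB; apply: eq_bigr => k _.
  by rewrite !mxE rmorphB /= mulrBl.
move=> Bij.
have : (B *m tA T) i i = (B *m tA T) j i.
  by rewrite !mxE; apply: eq_bigr => k _; rewrite (subr0_eq (Bij k)).
by rewrite mulVmx ?tA_unitmx // !mxE eqxx eq_sym (negbTE ij).
Qed.

Lemma column_addition_tw i j T T' : column_addition i j T T' ->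
  tw T' = sub_row j i (tw T).
Proof.
move=> [ij _ AE vE].
have uA := map_intr_unitmx (tA_unitmx T').
have : map_mx (intr : int -> R) (tA T') *m tw T' = map_mx intr (tA T') *m sub_row j i (tw T).
  by rewrite mul_tA_tw AE vE mul_add_col_sub_row // mul_tA_tw.
by move=> /(congr1 (mulmx (invmx (map_mx intr (tA T'))))); rewrite !mulKmx.
Qed.

Lemma column_step i j T : i != j -> tw T i 0 < tw T j 0 ->
  exists2 T', column_addition i j T T' & tw T' = sub_row j i (tw T).
Proof.
move=> ij wij.
have [||||||T' [AE vE wE]] := @triple_intro (add_col i j (tA T)) (tv T) (sub_row j i (tw T)).
- by move=> k l; rewrite mxE; case: ifP; rewrite ?addr_ge0 ?tA_ge0.
- by rewrite add_col_unitmx ?tA_unitmx.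
- exact: tv_gt0.
- exact: tv_indep.
- by rewrite mul_add_col_sub_row // mul_tA_tw.
- by move=> k; rewrite mxE; case: ifP; rewrite ?subr_gt0 ?tw_gt0.
by exists T' => //; split; rewrite // subr_gt0.
Qed.

Lemma row_step i j T : i != j -> (forall k, tA T i k <= tA T j k) ->
  exists T', row_subtraction j i T T'.
Proof.
move=> ij Aij.
have vE : map_mx intr (sub_row j i (tA T)) *m tw T = sub_row j i (tv T).
  by rewrite !sub_rowE map_mxM map_mxB map_mx1 map_delta_mx -mulmxA mul_tA_tw.
have [||||||T' [AE vE' wE]] := @triple_intro (sub_row j i (tA T)) (sub_row j i (tv T)) (tw T).
- by move=> k l; rewrite mxE; case: ifP; rewrite ?subr_ge0 ?tA_ge0.
- by rewrite sub_row_unitmx ?tA_unitmx.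
- move=> k; rewrite mxE; case: ifP => _; last exact: tv_gt0.
  rewrite subr_gt0 lt_neqAle tv_neq //= -mul_tA_tw !mxE.
  by apply: ler_sum => l _; rewrite !mxE ler_pM2r ?tw_gt0 // ler_int.
- move=> c cv.
  (* A relation [c] on the new vector is a relation on the old one, with [c i - c j] in place of
     [c i]. *)
  have /(@tv_indep _ _ T) c0 :
      \sum_k ratr (if k == i then c i - c j else c k) * tv T k 0 = 0.
    rewrite -[RHS]cv (bigD1 i) //= (bigD1 j) 1?eq_sym //= [RHS](bigD1 i) //=.
    rewrite [in RHS](bigD1 j) 1?eq_sym //= !mxE !eqxx (negbTE ij) eq_sym (negbTE ij).
    rewrite !addrA; congr (_ + _); first by rewrite rmorphB /=; ring.
    by apply: eq_bigr => k /andP[/negbTE ki /negbTE kj]; rewrite !mxE ki kj.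
  have cj : c j = 0 by have := c0 j; rewrite eq_sym (negbTE ij).
  move=> k; have := c0 k; case: eqP => [->|_ //].
  by rewrite cj subr0.
- exact: vE.
- exact: tw_gt0.
by exists T'.
Qed.

Lemma interchange_step i j T : i != j -> exists T', row_interchange i j T T'.
Proof.
move=> ij.
have [||||||T' [AE vE' wE]] := @triple_intro (xrow i j (tA T)) (xrow i j (tv T)) (tw T).
- by move=> k l; rewrite mxE tA_ge0.
- by rewrite xrowE unitmx_mul unitmx_perm tA_unitmx.
- by move=> k; rewrite mxE tv_gt0.
- move=> c cv k.
  have /(@tv_indep _ _ T) c0 : \sum_k ratr (c (tperm i j k)) * tv T k 0 = 0.
    rewrite (reindex_inj (@perm_inj _ (tperm i j))) -[RHS]cv /=.
    by apply: eq_bigr => l _; rewrite tpermK mxE.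
  by have := c0 (tperm i j k); rewrite tpermK.
- by rewrite !xrowE map_mxM map_perm_mx -mulmxA mul_tA_tw.
- exact: tw_gt0.
by exists T'.
Qed.

Definition forward_step T T' : Prop :=
  exists i j, column_addition i j T T' \/ row_interchange i j T T'.

Definition forward : triple R n -> triple R n -> Prop :=
  clos_refl_trans _ forward_step.

Lemma column_forward i j T : i != j -> tw T i 0 < tw T j 0 ->
  exists T', [/\ forward T T', tA T' = add_col i j (tA T)
    & tw T' = sub_row j i (tw T)].
Proof.
move=> ij /(column_step ij)[T' TT' wE]; exists T'; split=> //.
  by apply: rt_step; exists i, j; left.
by case: TT'.
Qed.

(* [c] stands for the coordinates, in the basis of the columns of [tA T], of a
   vector that stays fixed. *)
Definition reaches T (c : 'cV[int]_n) (P : triple R n -> 'cV[int]_n -> Prop) :=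
  exists T' c', [/\ forward T T', tA T' *m c' = tA T *m c & P T' c'].

Implicit Types (c : 'cV[int]_n) (P Q : triple R n -> 'cV[int]_n -> Prop).

Lemma reaches_here T c P : P T c -> reaches T c P.
Proof. by move=> PTc; exists T, c; split=> //; apply: rt_refl. Qed.

Lemma reaches_bind T c P Q : reaches T c P ->
  (forall T' c', tA T' *m c' = tA T *m c -> P T' c' -> reaches T' c' Q) ->
  reaches T c Q.
Proof.
move=> [T1 [c1 [TT1 e1 P1]]] /(_ _ _ e1 P1)[T2 [c2 [TT2 e2 Q2]]].
by exists T2, c2; split=> //; [apply: rt_trans TT1 TT2 | rewrite e2].
Qed.

Lemma reaches_step i j T c : i != j -> tw T i 0 < tw T j 0 ->
  reaches T c (fun T' c' => tw T' = sub_row j i (tw T) /\ c' = sub_row j i c).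
Proof.
move=> ij /(column_forward ij)[T' [TT' AE wE]].
exists T', (sub_row j i c); split=> //; rewrite AE.
have := mul_add_col_sub_row idfun (tA T) c ij.
by rewrite !map_mx_id.
Qed.

Lemma reachesN T c P : reaches T (- c) (fun T' c' => P T' (- c')) -> reaches T c P.
Proof.
move=> [T' [c' [TT' e Pc']]]; exists T', (- c'); split=> //.
by rewrite mulmxN e mulmxN opprK.
Qed.

End Triples.

(** * Making a column of the inverse matrix a difference of unit vectors *)

Section CoordinateGame.
Variables (R : realType) (n : nat).
Implicit Types (T : triple R n) (c : 'cV[int]_n) (i j k l : 'I_n) (M : int).

Lemma archimedean_mul (x y : R) : 0 < y -> exists N : nat, x < N%:R * y.
Proof.
move=> y0; exists (Num.truncn (x / y)).+1.
by rewrite -ltr_pdivrMr // truncnS_gt.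
Qed.

(** Moves between [i] and [j] must not disturb a third, extremal entry or its weight; the inequality
    preserves an upper bound on the weights of [i] and [j]. *)
Definition confined i j T c T' c' :=
  (forall l, l != i -> l != j -> c' l 0 = c l 0 /\ tw T' l 0 = tw T l 0) /\
  (forall l, tw T' l 0 <= tw T l 0).

Lemma confined_trans i j T1 c1 T2 c2 T3 c3 :
  confined i j T1 c1 T2 c2 -> confined i j T2 c2 T3 c3 -> confined i j T1 c1 T3 c3.
Proof.
move=> [e12 le12] [e23 le23]; split=> l.
  by move=> li lj; have [-> ->] := e23 l li lj; apply: e12.
exact: le_trans (le23 l) (le12 l).
Qed.

Lemma confinedC i j T c T' c' : confined i j T c T' c' -> confined j i T c T' c'.
Proof. by move=> [e le]; split=> // l lj li; apply: e. Qed.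

Lemma confined_step i j T c T' :
  tw T' = sub_row j i (tw T) -> confined i j T c T' (sub_row j i c).
Proof.
move=> wE; split=> l; first by move=> _ /negbTE lj; rewrite wE !mxE lj.
by rewrite wE mxE; case: eqP => // ->; rewrite gerBl ltW // tw_gt0.
Qed.

(** Subtracting the zero entry [i] from entry [j] leaves [c] alone but lowers [w_j] by [w_i]. After
    finitely many such steps [w_j < w_i], and the subtraction the other way turns the zero into
    [- c j 0]. *)
Lemma reaches_opposite_of_zero i j T c : i != j -> c i 0 = 0 ->
  reaches T c (fun T' c' => confined i j T c T' c' /\
    (c' i 0 = - c j 0 /\ c' j 0 = c j 0)).
Proof.
move=> ij ci; have [N] := archimedean_mul (tw T j 0) (tw_gt0 T i).
elim: N T c ci => [|N IH] T c ci wN.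
  by have := tw_gt0 T j; rewrite ltNge ltW // (lt_le_trans wN) // mul0r.
have [wij|wji|/eqP] := ltgtP (tw T i 0) (tw T j 0).
- apply: reaches_bind (reaches_step c ij wij) _ => T1 _ _ [wE ->].
  have c1i : sub_row j i c i 0 = 0 by rewrite mxE (negbTE ij).
  have c1j : sub_row j i c j 0 = c j 0 by rewrite mxE eqxx ci subr0.
  apply: reaches_bind (IH T1 (sub_row j i c) c1i _) _.
    rewrite wE !mxE eqxx (negbTE ij) ltrBlDr.
    by rewrite -[X in _ + X]mul1r -mulrDl natr1.
  move=> T2 c2 _ [conf [c2i c2j]]; apply: reaches_here; split.
    exact: confined_trans (confined_step c wE) conf.
  by rewrite c2i c2j c1j.
- have ji : j != i by rewrite eq_sym.
  apply: reaches_bind (reaches_step c ji wji) _ => T1 _ _ [wE ->].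
  apply: reaches_here; split; first by apply/confinedC/confined_step.
  by rewrite !mxE eqxx (negbTE ji) ci sub0r.
- by rewrite (negbTE (tw_neq T ij)).
Qed.

(* A bound [|c l 0| <= M] propagates along [tame], and no new entry of absolute
   value [M] appears. *)
Definition tame M c c' := forall l, `|c' l 0| < M \/ c' l 0 = c l 0.

Lemma tame_trans M c1 c2 c3 : tame M c1 c2 -> tame M c2 c3 -> tame M c1 c3.
Proof. by move=> t12 t23 l; have [?|->] := t23 l; [left|apply: t12]. Qed.

Lemma tame_step M i j c : `|c j 0 - c i 0| < M -> tame M c (sub_row j i c).
Proof. by move=> lt l; rewrite mxE; case: eqP => [->|]; [left|right]. Qed.

Lemma tame_bounded M c c' : tame M c c' ->
  (forall l, `|c l 0| <= M) -> forall l, `|c' l 0| <= M.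
Proof. by move=> t b l; have [/ltW|->] := t l. Qed.

(** Without opposite signs the difference is at most [M] in absolute value, with equality only when
    one number is [0] and the other [M] up to sign; then [M] divides both. *)
Lemma norm_sub_lt M (a b : int) : `|a| <= M -> `|b| <= M -> 0 <= a * b ->
  ~ ((M %| a)%Z /\ (M %| b)%Z) -> `|b - a| < M.
Proof.
move=> aM bM ab nd; rewrite ltNge; apply/negP => leM; apply: nd.
have [[-> ba]|[ba ->]] : (a = 0 /\ (b = M \/ b = - M)) \/ ((a = M \/ a = - M) /\ b = 0).
  have [a0|a0|a0] := ltgtP a 0; first by move: ab; rewrite nmulr_rge0 //; lia.
    by move: ab; rewrite pmulr_rge0 //; lia.
  by lia.
- by rewrite dvdz0; case: ba => ->; rewrite ?rpredN dvdzz.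
- by rewrite dvdz0; case: ba => ->; rewrite ?rpredN dvdzz.
Qed.

Lemma absz_sub_lt (a b : int) : a != 0 -> 0 <= a * (b - a) -> (`|b - a| < `|b|)%N.
Proof.
have [a0|a0|->//] := ltgtP a 0 => _; first by rewrite nmulr_rge0 //; lia.
by rewrite pmulr_rge0 //; lia.
Qed.

Lemma ndvd_sub M (a b : int) : ~ ((M %| a)%Z /\ (M %| b)%Z) ->
  ~ ((M %| a)%Z /\ (M %| b - a)%Z).
Proof.
move=> nd [Ma Mba]; apply: nd; split=> //.
by rewrite -[b](subrK a) rpredD.
Qed.

(** Subtractive Euclidean algorithm in the order dictated by [w]: while the signs agree and the
    subtracted entry is nonzero, the sum of the two absolute values drops. A zero subtracted entry
    is handled by [reaches_opposite_of_zero]. *)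
Lemma reaches_opposite M i j T c : i != j ->
  `|c i 0| <= M -> `|c j 0| <= M -> 0 <= c i 0 * c j 0 ->
  ~ ((M %| c i 0%R)%Z /\ (M %| c j 0%R)%Z) ->
  reaches T c (fun T' c' => [/\ confined i j T c T' c', tame M c c',
    ~ ((M %| c' i 0%R)%Z /\ (M %| c' j 0%R)%Z) & c' i 0 * c' j 0 < 0]).
Proof.
have [N] := ubnP (`|c i 0%R| + `|c j 0%R|)%N.
elim: N i j T c => // N IH i j T c leN ij.
wlog wij : i j ij leN / tw T i 0 < tw T j 0.
  move=> W iM jM cij nd.
  have [wij|wji|/eqP] := ltgtP (tw T i 0) (tw T j 0); first exact: W.
    apply: reaches_bind (W j i _ _ wji _ _ _ _) _; rewrite 1?eq_sym 1?addnC 1?mulrC //.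
      by move=> [? ?]; apply: nd.
    move=> T' c' _ [conf t nd' opp]; apply: reaches_here; split=> //.
    - exact: confinedC.
    - by move=> [? ?]; apply: nd'.
    - by rewrite mulrC.
  by rewrite (negbTE (tw_neq T ij)).
move=> iM jM cij nd.
have [ci0|ci0] := eqVneq (c i 0) 0.
  (* Entry [i] will become [- c j 0], so tameness needs this strict bound. *)
  have jlt : `|c j 0| < M.
    by have := norm_sub_lt iM jM cij nd; rewrite ci0 subr0.
  have cj0 : c j 0 != 0.
    by apply/eqP => cj0; apply: nd; rewrite ci0 cj0 !dvdz0.
  apply: reaches_bind (reaches_opposite_of_zero T ij ci0) _.
  move=> T' c' _ [conf [c'i c'j]]; apply: reaches_here; split=> //.
  - move=> l; have [->|li] := eqVneq l i; first by left; rewrite c'i normrN.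
    have [->|lj] := eqVneq l j; first by right.
    by right; case: conf => /(_ l li lj)[].
  - by rewrite c'i c'j rpredN => -[? ?]; apply: nd; rewrite ci0 dvdz0.
  - by rewrite c'i c'j mulNr oppr_lt0 -expr2 exprn_even_gt0.
have lt := norm_sub_lt iM jM cij nd.
apply: reaches_bind (reaches_step c ij wij) _ => T1 _ _ [wE ->].
have c1i : sub_row j i c i 0 = c i 0 by rewrite mxE (negbTE ij).
have c1j : sub_row j i c j 0 = c j 0 - c i 0 by rewrite mxE eqxx.
have nd1 := ndvd_sub nd.
have [opp|same] := ltP (c i 0 * (c j 0 - c i 0)) 0.
  apply: reaches_here; rewrite c1i c1j; split=> //; last exact: tame_step.
  exact: confined_step.
apply: reaches_bind (IH i j T1 (sub_row j i c) _ ij _ _ _ _) _; rewrite ?c1i ?c1j //.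
- rewrite -ltnS; apply: leq_ltn_trans leN.
  by rewrite ltn_add2l absz_sub_lt.
- exact: ltW.
move=> T2 c2 _ [conf t nd2 opp]; apply: reaches_here; split=> //.
- exact: confined_trans (confined_step c wE) conf.
- exact: tame_trans (tame_step lt) t.
Qed.

End CoordinateGame.

(** * Lowering the largest absolute value of the coordinates *)

Section CoordinateBound.
Variables (R : realType) (n : nat).
Implicit Types (T : triple R n) (c : 'cV[int]_n) (i j k l : 'I_n) (M : int).

Definition extremal M c : {set 'I_n} := [set l | `|c l 0| == M].

Lemma extremal_tame M c c' : tame M c c' -> extremal M c' \subset extremal M c.
Proof.
move=> t; apply/subsetP => l; rewrite !inE.
by have [lt /eqP eq|->//] := t l; rewrite eq ltxx in lt.
Qed.

Lemma extremal_tame_proper M k c c' : tame M c c' ->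
  k \in extremal M c -> k \notin extremal M c' ->
  (#|extremal M c'| < #|extremal M c|)%N.
Proof.
move=> t kc kc'; apply: proper_card; apply/properP.
by split; [apply: extremal_tame | exists k].
Qed.

(* If [c i 0 > 0], either entry [i] can be subtracted from the extremal entry [k],
   or entry [k] from entry [i], which lowers [tw T i 0] by [tw T k 0]: hence the
   induction on [N].  The divisibility hypothesis keeps [c i 0] and [c j 0] from
   vanishing together, so that a positive one can always be produced. *)
Lemma lower_extremal_pos M (B N : nat) i j k T c :
    i != j -> i != k -> j != k -> c k 0 = M -> 0 < M ->
    (forall l, `|c l 0| <= M) ->
    ~ ((M %| c i 0%R)%Z /\ (M %| c j 0%R)%Z) ->
    tw T i 0 + tw T j 0 < N%:R * tw T k 0 ->
    (#|extremal M c| <= B)%N ->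
  reaches T c (fun T' c' =>
    (forall l, `|c' l 0| <= M) /\ (#|extremal M c'| < B)%N).
Proof.
elim: N i j T c => [|N IH] i j T c ij ik jk ck M0 cM nd wN cB.
  have := tw_gt0 T i; have := tw_gt0 T j.
  by rewrite mul0r in wN; lra.
(* [mid] records what survives making one of the entries [i], [j] positive. *)
pose mid T' (c' : 'cV[int]_n) := [/\ tame M c c', c' k 0 = M /\
  tw T' k 0 = tw T k 0, tw T' i 0 + tw T' j 0 <= tw T i 0 + tw T j 0,
  ~ ((M %| c' i 0%R)%Z /\ (M %| c' j 0%R)%Z) & 0 < c' i 0 \/ 0 < c' j 0].
have mid_reached : reaches T c mid.
  have [ci|ci] := ltP 0 (c i 0).
    by apply: reaches_here; split=> //; [right | left].
  have [cj|cj] := ltP 0 (c j 0).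
    by apply: reaches_here; split=> //; right.
  apply: reaches_bind (reaches_opposite T ij (cM i) (cM j) _ nd) _.
    exact: mulr_le0.
  move=> T' c' _ [[conf le] t nd' opp]; apply: reaches_here.
  have [c'k wk] : c' k 0 = c k 0 /\ tw T' k 0 = tw T k 0.
    by apply: conf; rewrite eq_sym.
  split; rewrite ?c'k //; first exact: lerD.
  have [ci'|ci'|ci'] := ltgtP (c' i 0) 0; last by rewrite ci' mul0r in opp.
    by right; rewrite nmulr_rlt0 in opp.
  by left.
apply: reaches_bind mid_reached _ => T1 c1 _ [t [c1k wk] wij nd1 pos].
have {}cM := tame_bounded t cM.
have {t}cB : (#|extremal M c1| <= B)%N.
  exact: leq_trans (subset_leq_card (extremal_tame t)) cB.
have {wij}wN : tw T1 i 0 + tw T1 j 0 < N.+1%:R * tw T1 k 0.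
  by rewrite wk; apply: le_lt_trans wN.
clear T c ck nd wk mid; move: T1 c1 c1k nd1 pos cM cB wN => T c ck nd pos cM cB wN.
wlog ci : i j ij ik jk nd pos wN / 0 < c i 0.
  move=> W; have [ci|ci] := pos; first exact: (W i j).
  apply: (W j i) => //; rewrite 1?eq_sym 1?addrC //.
    by move=> [? ?]; apply: nd.
  by left.
(* Either subtraction between [i] and [k] produces an entry of absolute value below [M], so both are
   tame. *)
have ciM := cM i; have ltM : `|c i 0 - M| < M.
  by move: ciM ci; lia.
have ki : k != i by rewrite eq_sym.
have [wik|wki|/eqP] := ltgtP (tw T i 0) (tw T k 0).
- apply: reaches_bind (reaches_step c ik wik) _ => T1 _ _ [_ ->].
  have t : tame M c (sub_row k i c) by apply: tame_step; rewrite ck distrC.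
  apply: reaches_here; split; first exact: tame_bounded t cM.
  apply: leq_trans cB; apply: (extremal_tame_proper t (k := k)).
    by rewrite inE ck gtr0_norm.
  by rewrite inE mxE eqxx ck distrC neq_lt ltM.
- apply: reaches_bind (reaches_step c ki wki) _ => T1 _ _ [wE ->].
  have t : tame M c (sub_row i k c) by apply: tame_step; rewrite ck.
  apply: (IH i j) => //.
  + by rewrite mxE (negbTE ki).
  + exact: tame_bounded t cM.
  + rewrite !mxE eqxx eq_sym (negbTE ij) ck.
    by move=> [Mi Mj]; apply: nd; split=> //; rewrite -[c i 0](subrK M) rpredD.
  + rewrite wE !mxE eqxx (negbTE ki) [j == i]eq_sym (negbTE ij).
    by move: wN; rewrite -natr1; lra.
  + exact: leq_trans (subset_leq_card (extremal_tame t)) cB.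
- by rewrite (negbTE (tw_neq T ik)).
Qed.

Lemma third_index i j : (2 < n)%N -> exists l, l != i /\ l != j.
Proof.
move=> n2; have : (0 < #|~: [set i; j]|)%N.
  rewrite cardsCs setCK card_ord subn_gt0; apply: leq_ltn_trans n2.
  by rewrite cards2; case: (_ != _).
by move=> /card_gt0P[l]; rewrite !inE negb_or => /andP[li lj]; exists l.
Qed.

(** Some integer combination of the entries of [c] equals [1], so some entry [i] is not a multiple
    of [M], which also separates it from the extremal entry [k]. The remaining index [j] exists
    because [n > 2]. *)
Lemma lower_extremal M T c r : (2 < n)%N -> 1 < M ->
    (forall l, `|c l 0| <= M) -> (0 < #|extremal M c|)%N ->
    tA T *m c = delta_mx r 0 ->
  reaches T c (fun T' c' =>
    (forall l, `|c' l 0| <= M) /\ (#|extremal M c'| < #|extremal M c|)%N).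
Proof.
move=> n2 M1 cM /card_gt0P[k]; rewrite inE => /eqP ck Ac.
have [i nMi] : exists i, ~~ (M %| c i 0%R)%Z.
  apply/existsP; rewrite -negb_forall; apply/negP => /forallP dvd.
  have : (M %| (tA T *m c) r 0%R)%Z.
    by rewrite mxE rpred_sum // => l _; rewrite dvdz_mull.
  by rewrite Ac mxE !eqxx dvdz1; lia.
have ik : i != k.
  apply: contraNneq nMi => ->.
  have [s|s] := lerP 0 (c k 0); rewrite -ck; first by rewrite ger0_norm ?dvdzz.
  by rewrite ltr0_norm // -[X in (_ %| X)%Z]opprK rpredN dvdzz.
have [j [ji jk]] := third_index i k n2.
have [N wN] := archimedean_mul (tw T i 0 + tw T j 0) (tw_gt0 T k).
have [ck0|ck0] := lerP 0 (c k 0).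
  apply: lower_extremal_pos wN _ => //; rewrite 1?eq_sym //; last 1 first.
  - by move=> [Mi _]; rewrite Mi in nMi.
  - by rewrite -ck ger0_norm.
  - exact: lt_trans M1.
(* A negative extremal entry becomes positive in [- c]. *)
apply: reachesN.
have extN d : extremal M (- d) = extremal M d.
  by apply/setP => l; rewrite !inE mxE normrN.
have : reaches T (- c) (fun T' c' =>
    (forall l, `|c' l 0| <= M) /\ (#|extremal M c'| < #|extremal M c|)%N).
  apply: (@lower_extremal_pos M _ N i j k) => //; rewrite 1?eq_sym ?extN //.
  - by rewrite mxE -ck ltr0_norm.
  - exact: lt_trans M1.
  - by move=> l; rewrite mxE normrN.
  - by rewrite !mxE !rpredN; move=> [Mi _]; rewrite Mi in nMi.
move=> red; apply: reaches_bind red _ => T' c' _ [bnd lt]; apply: reaches_here.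
by rewrite extN; split=> // l; rewrite mxE normrN.
Qed.

(** Induction on the bound and, for a fixed bound, on the number of entries attaining it. *)
Lemma reaches_bounded_by_1 T c r : (2 < n)%N -> tA T *m c = delta_mx r 0 ->
  reaches T c (fun _ c' => forall l, `|c' l 0| <= 1).
Proof.
move=> n2 Ac.
have [M cM] : exists M : nat, forall l, `|c l 0| <= M.+1%:Z.
  exists (\max_l `|c l 0%R|%N) => l; rewrite -abszE lez_nat.
  by apply: leqW; apply: (leq_bigmax l).
elim: M T c Ac cM => [|M IHM] T c Ac cM; first exact: reaches_here.
have [B] := ubnP #|extremal M.+2%:Z c|.
elim: B T c Ac cM => // B IHB T c Ac cM leB.
have [ext|ext] := posnP #|extremal M.+2%:Z c|.
  apply: IHM Ac _ => l; have := cM l.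
  have : l \notin extremal M.+2%:Z c by rewrite (cards0_eq ext) inE.
  by rewrite inE; lia.
apply: reaches_bind (lower_extremal n2 _ cM ext Ac) _ => //.
move=> T1 c1 e1 [c1M lt]; apply: IHB c1M _; first by rewrite e1.
exact: leq_trans lt _.
Qed.

(** With entries in [{-1, 0, 1}], two nonzero entries of the same sign are equal, so a subtraction
    cancels one and shrinks the support. In the end each sign occurs at most once. *)
Lemma reaches_difference T c r : (2 < n)%N -> tA T *m c = delta_mx r 0 ->
  reaches T c (fun _ c' =>
    exists p q, p != q /\ c' = delta_mx p 0 - delta_mx q 0).
Proof.
move=> n2 Ac.
apply: reaches_bind (reaches_bounded_by_1 n2 Ac) _ => T1 c1.
rewrite Ac => {c Ac}; move: T1 c1 => {}T c Ac c1.
have [N] := ubnP #|[set l | c l 0 != 0]|.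
elim: N T c Ac c1 => // N IH T c Ac c1 leN.
have [/existsP[i /existsP[j /and3P[ij cij wij]]]|none] :=
    boolP [exists i, exists j, [&& i != j, 0 < c i 0 * c j 0 & tw T i 0 < tw T j 0]].
  have cE : c j 0 = c i 0 by have := c1 i; have := c1 j; nia.
  apply: reaches_bind (reaches_step c ij wij) _ => T1 c' e1 [_ c'E]; subst c'.
  apply: IH; first by rewrite e1.
    move=> l; rewrite mxE; case: eqP => // _; by rewrite cE subrr.
  rewrite -ltnS; apply: leq_ltn_trans leN; apply: proper_card.
  apply/properP; split.
    apply/subsetP => l; rewrite !inE mxE.
    by have [->|//] := eqVneq l j; rewrite cE subrr eqxx.
  exists j; rewrite !inE ?mxE ?eqxx ?cE ?subrr ?eqxx //.
  by apply: contraTneq cij => ->; rewrite mul0r ltxx.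
have {}none i j : i != j -> c i 0 * c j 0 <= 0.
  move=> ij; rewrite leNgt; apply/negP => cij.
  have [wij|wji|/eqP] := ltgtP (tw T i 0) (tw T j 0).
  - by case/existsP: none; exists i; apply/existsP; exists j; apply/and3P.
  - by case/existsP: none; exists j; apply/existsP; exists i; rewrite eq_sym mulrC; apply/and3P.
  - by rewrite (negbTE (tw_neq T ij)).
(* Since [tA T] is non-negative and [tA T *m c] has an entry [1], [c] cannot be non-positive. *)
have [p cp] : exists p, 0 < c p 0.
  apply/existsP; apply: contraT; rewrite negb_exists => /forallP np.
  have : (tA T *m c) r 0 <= 0.
    rewrite mxE sumr_le0 // => l _.
    by rewrite mulr_ge0_le0 ?tA_ge0 // leNgt.
  by rewrite Ac mxE !eqxx.
have {}cp : c p 0 = 1 by have := c1 p; lia.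
have [/existsP[q cq]|nq] := boolP [exists q, c q 0 < 0].
  have pq : p != q by apply: contraTneq cq => <-; rewrite cp.
  have {}cq : c q 0 = -1 by have := c1 q; lia.
  apply: reaches_here; exists p, q; split=> //.
  apply/matrixP => l z; rewrite !mxE (ord1 z) eqxx !andbT.
  have [->|lp] := eqVneq l p; first by rewrite cp (negbTE pq) subr0.
  have [->|lq] := eqVneq l q; first by rewrite cq sub0r.
  by have := none l p lp; have := none l q lq; rewrite cp cq; lia.
(* Here [c] is the unit vector at [p]; any other entry [q], being zero, can be turned into [-1]. *)
have [q [qp _]] := third_index p p n2.
have c0 l : l != p -> c l 0 = 0.
  move=> lp; apply/eqP; rewrite eq_le.
  have := none l p lp; rewrite cp mulr1 => -> /=.
  by move: nq; rewrite negb_exists => /forallP/(_ l); rewrite -leNgt.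
apply: reaches_bind (reaches_opposite_of_zero T qp (c0 q qp)) _.
move=> T1 c2 _ [[conf _] [cq' cp']]; apply: reaches_here.
exists p, q; rewrite eq_sym; split=> //.
apply/matrixP => l z; rewrite !mxE (ord1 z) eqxx !andbT.
have [->|lp] := eqVneq l p; first by rewrite cp' cp eq_sym (negbTE qp) subr0.
have [->|lq] := eqVneq l q; first by rewrite cq' cp sub0r.
by have [-> _] := conf l lq lp; rewrite c0.
Qed.

End CoordinateBound.

(** * Row reduction *)

(** Permissibility of a row subtraction depends only on the matrix, so this phase is studied without
    [v] and [w]. *)
Definition row_reduction_step n (A A' : 'M[int]_n) : Prop :=
  exists i j, [/\ i != j, forall k, A i k <= A j k & A' = sub_row j i A].

Definition reduces n : 'M[int]_n -> 'M[int]_n -> Prop :=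
  clos_refl_trans_1n _ (@row_reduction_step n).

Section Lifting.
Variable m : nat.
Implicit Types (A : 'M[int]_m.+1) (F : 'M[int]_m) (p : 'I_m.+1) (q : 'I_m).

Lemma lift_eqE p (i j : 'I_m) : (lift p i == lift p j) = (i == j).
Proof. exact: (inj_eq (@lift_inj _ p)). Qed.

Lemma lift_eqF p (i : 'I_m) : (lift p i == p) = false.
Proof. by rewrite eq_sym (negbTE (neq_lift p i)). Qed.

(** Row [lift p l] is a unit row, plus a [1] in column [p] when [l = q]. Subtracting such rows from
    row [p] clears it outside column [p], and the sum of its other entries drops each time. *)
Lemma reduces_bordered_identity p q A :
    (forall k, A k p = (k == p)%:Z + A k (lift p q)) ->
    (forall i j, A (lift p i) (lift p j) = (i == j)%:Z) ->
    (forall k, 0 <= A p k) ->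
  reduces A 1%:M.
Proof.
have [N] := ubnP (\sum_j `|A p (lift p j)|)%N.
elim: N A => // N IH A leN Ap AI A0.
have [/existsP[l yl]|/existsPn y0] := boolP [exists l, A p (lift p l) != 0].
  have lp : lift p l != p by rewrite lift_eqF.
  have y1 : 1 <= A p (lift p l) by have := A0 (lift p l); lia.
  apply: (Relation_Operators.rt1n_trans _ _ _ (sub_row p (lift p l) A)).
    exists (lift p l), p; split=> // k.
    have [j ->|->] := unliftP p k.
      by rewrite AI; case: eqP => [<-//|_]; apply: A0.
    rewrite !Ap eqxx lift_eqF AI add0r.
    by case: eqP => [<-|_]; have := A0 (lift p q); lia.
  have B k : sub_row p (lift p l) A p k = A p k - A (lift p l) k by rewrite mxE eqxx.
  have B' i k : sub_row p (lift p l) A (lift p i) k = A (lift p i) k.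
    by rewrite mxE lift_eqF.
  apply: IH.
  - rewrite -ltnS; apply: leq_ltn_trans leN.
    rewrite (bigD1 l) //= [X in (_ < X)%N](bigD1 l) //= B AI eqxx -addSn leq_add //.
      lia.
    by apply: leq_sum => j jl; rewrite B AI eq_sym (negbTE jl) subr0.
  - move=> k; have [i ->|->] := unliftP p k; first by rewrite !B' Ap.
    by rewrite !B !Ap eqxx lift_eqF; lia.
  - by move=> i j; rewrite B' AI.
  - move=> k; rewrite B; have [j ->|->] := unliftP p k.
      rewrite AI; case: eqP => [<-|_]; rewrite ?subr0 ?A0 //; lia.
    rewrite !Ap eqxx lift_eqF AI.
    by case: eqP => [<-|_]; have := A0 (lift p q); lia.
have {}y0 j : A p (lift p j) = 0 by apply/eqP; have := y0 j; rewrite negbK.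
(* Row [p] is now a unit row, and the only wrong entry left is the [1] in row [lift p q], column
   [p]. *)
apply: (Relation_Operators.rt1n_trans _ _ _ (sub_row (lift p q) p A)); last first.
  have -> : sub_row (lift p q) p A = 1%:M.
    apply/matrixP => i j; rewrite !mxE.
    have pE i' : (p == lift p i') = false by rewrite eq_sym lift_eqF.
    have [i' ->|->] := unliftP p i; have [j' ->|->] := unliftP p j.
    - by rewrite y0 subr0 !lift_eqE; case: eqVneq => [->|_]; rewrite AI; case: eqP.
    - rewrite lift_eqE lift_eqF !Ap !lift_eqF eqxx y0.
      by case: eqVneq => [_|/negbTE iq]; rewrite AI ?eqxx ?iq.
    - by rewrite !pE y0.
    - by rewrite pE Ap y0 eqxx.
  exact: rt1n_refl.
exists p, (lift p q); split; rewrite ?neq_lift // => k.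
have [j ->|->] := unliftP p k; first by rewrite y0 AI.
by rewrite !Ap eqxx lift_eqF y0 AI eqxx.
Qed.

(** A row subtraction on [F] stays permissible on [A]: outside row [p], column [p] repeats column
    [lift p q], where the comparison already holds. *)
Lemma reduces_bordered p q F A : reduces F 1%:M ->
    (forall k, A k p = (k == p)%:Z + A k (lift p q)) ->
    (forall i j, F i j = A (lift p i) (lift p j)) ->
    (forall k, 0 <= A p k) ->
  reduces A 1%:M.
Proof.
move=> red; move E : 1%:M red => I red.
elim: red A E => {F I} [F|F F' I [i [j [ij Fij ->]]] _ IH] A E Ap FA A0.
  by apply: (@reduces_bordered_identity p q) => // i j; rewrite -FA -E mxE; case: eqP.
apply: (Relation_Operators.rt1n_trans _ _ _ (sub_row (lift p j) (lift p i) A)).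
  exists (lift p i), (lift p j); split; rewrite ?lift_eqE // => k.
  have [l ->|->] := unliftP p k; first by rewrite -!FA.
  by rewrite !Ap !lift_eqF -!FA lerD2l.
apply: IH => //.
- move=> k; rewrite !mxE; have [->|_] := eqVneq k (lift p j); last exact: Ap.
  by rewrite !Ap !lift_eqF !add0r.
- by move=> k l; rewrite !mxE lift_eqE !FA.
- by move=> k; rewrite mxE [p == _]eq_sym lift_eqF.
Qed.

End Lifting.

(** * Row reduction in dimension two *)

Lemma det_mx22 (S : comPzRingType) (A : 'M[S]_2) :
  \det A = A 0 0 * A 1 1 - A 0 1 * A 1 0.
Proof.
rewrite (expand_det_row _ 0) !big_ord_recl big_ord0 addr0 /cofactor !det_mx11 !mxE /=.
rewrite expr0 expr1 mul1r mulN1r mulrN.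
by congr (A _ _ * A _ _ - A _ _ * A _ _); apply: val_inj.
Qed.

(** Incomparable rows cross strictly. One crossing gives [a * d >= (c + 1) * (b + 1)], so
    determinant [1] forces [b = c = 0]; the other makes the determinant negative. *)
Lemma incomparable_rows (a b c d : int) :
    0 <= a -> 0 <= b -> 0 <= c -> 0 <= d -> a * d - b * c = 1 ->
    ~~ ((a <= c) && (b <= d)) -> ~~ ((c <= a) && (d <= b)) ->
  [/\ a = 1, b = 0, c = 0 & d = 1].
Proof.
move=> a0 b0 c0 d0 det n1 n2.
have [[ca bd]|[ac db]] : (c < a /\ b < d) \/ (a < c /\ d < b) by lia.
  have le : (c + 1) * (b + 1) <= a * d by apply: ler_pM; lia.
  have bc : b + c = 0 by nia.
  have [b1 c1] : b = 0 /\ c = 0 by lia.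
  subst b c; have ad : a * d = 1 by lia.
  by split=> //; nia.
have le : (a + 1) * (d + 1) <= c * b by apply: ler_pM; lia.
by exfalso; nia.
Qed.

(** While the rows are comparable, the smaller is subtracted from the larger; neither row is zero,
    so the sum of the entries decreases. *)
Lemma reduces2 (A : 'M[int]_2) : (forall i j, 0 <= A i j) -> \det A = 1 ->
  reduces A 1%:M.
Proof.
have ord2 (k : 'I_2) : k = 0 \/ k = 1.
  by case: k => [[|[|//]] ?]; [left | right]; apply: val_inj.
have [N] := ubnP (`|A 0%R 0%R| + `|A 0%R 1%R| + `|A 1%R 0%R| + `|A 1%R 1%R|)%N.
elim: N A => // N IH A leN A0; rewrite det_mx22 => dA.
have a0 := A0 0 0; have b0 := A0 0 1; have c0 := A0 1 0; have d0 := A0 1 1.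
have ab : 0 < A 0 0 + A 0 1.
  rewrite lt_neqAle addr_ge0 // andbT eq_sym paddr_eq0 //.
  by apply: contra_eqN dA => /andP[/eqP-> /eqP->]; rewrite !mul0r.
have cd : 0 < A 1 0 + A 1 1.
  rewrite lt_neqAle addr_ge0 // andbT eq_sym paddr_eq0 //.
  by apply: contra_eqN dA => /andP[/eqP-> /eqP->]; rewrite !mulr0.
have [/andP[ac bd]|n01] := boolP ((A 0 0 <= A 1 0) && (A 0 1 <= A 1 1)).
  apply: (Relation_Operators.rt1n_trans _ _ _ (sub_row 1 0 A)).
    by exists 0, 1; split=> // k; have [->|->] := ord2 k.
  apply: IH; rewrite ?det_mx22 ?mxE /=.
  - by move: leN; clear -ab ac bd a0 b0; lia.
  - by move=> i j; rewrite mxE; case: ifP => // _; rewrite subr_ge0; have [->|->] := ord2 j.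
  - by rewrite -[RHS]dA; ring.
have [/andP[ca db]|n10] := boolP ((A 1 0 <= A 0 0) && (A 1 1 <= A 0 1)).
  apply: (Relation_Operators.rt1n_trans _ _ _ (sub_row 0 1 A)).
    by exists 1, 0; split=> // k; have [->|->] := ord2 k.
  apply: IH; rewrite ?det_mx22 ?mxE /=.
  - by move: leN; clear -cd ca db c0 d0; lia.
  - by move=> i j; rewrite mxE; case: ifP => // _; rewrite subr_ge0; have [->|->] := ord2 j.
  - by rewrite -[RHS]dA; ring.
suff -> : A = 1%:M by apply: rt1n_refl.
have [A00 A01 A10 A11] : [/\ A 0 0 = 1, A 0 1 = 0, A 1 0 = 0 & A 1 1 = 1].
  exact: incomparable_rows.
apply/matrixP => i j; rewrite mxE.
by have [->|->] := ord2 i; have [->|->] := ord2 j.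
Qed.

(** * Lifting from dimension [n - 1] *)

Section Shadow.
Variables (R : realType) (m : nat).
Implicit Types (p : 'I_m.+1) (q : 'I_m).

(* [G] is [T] with row and column [p] deleted; column [p] of [T] is accounted for
   by adding its weight to that of column [q]. *)
Definition shadows p q (T : triple R m.+1) (G : triple R m) := [/\
  forall k, tA T k p = (k == p)%:Z + tA T k (lift p q),
  forall i j, tA G i j = tA T (lift p i) (lift p j) &
  forall j, tw G j 0 = tw T (lift p j) 0 + (j == q)%:R * tw T p 0].

Lemma shadow_exists p q (T : triple R m.+1) :
  (forall k, tA T k p = (k == p)%:Z + tA T k (lift p q)) ->
  exists G, shadows p q T G.
Proof.
move=> Ap.
pose F := row' p (col' p (tA T)).
pose v := \col_i tv T (lift p i) 0.
pose w := \col_j (tw T (lift p j) 0 + (j == q)%:R * tw T p 0).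
have [||||||G [AE _ wE]] := @triple_intro R m F v w.
- by move=> i j; rewrite !mxE tA_ge0.
(* Multiplying [A c = e_p] by the adjugate gives [adj A e_p = det A c]; its entry [p] says that the
   minor [F] has the determinant of [A]. *)
- pose c : 'cV[int]_m.+1 := delta_mx p 0 - delta_mx (lift p q) 0.
  have Ac : tA T *m c = delta_mx p 0.
    apply/matrixP => k z; rewrite mulmxBr -!colE !mxE (ord1 z) Ap addrK eqxx andbT.
    by case: (k == p).
  have := mulmxA (\adj (tA T)) (tA T) c.
  rewrite Ac mul_adj_mx mul_scalar_mx => /matrixP/(_ p 0).
  rewrite -colE !mxE !eqxx [p == _]eq_sym lift_eqF subr0 mulr1.
  rewrite /cofactor -signr_odd addnn odd_double expr0 mul1r => dF.
  by rewrite unitmxE dF -unitmxE tA_unitmx.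
- by move=> i; rewrite mxE tv_gt0.
- move=> c cv i.
  have /(@tv_indep _ _ T) c0 :
      \sum_k ratr (if unlift p k is Some i then c i else 0) * tv T k 0 = 0.
    rewrite (bigD1_ord p) //= unlift_none rmorph0 mul0r add0r -[RHS]cv.
    by apply: eq_bigr => k _; rewrite liftK mxE.
  by have := c0 (lift p i); rewrite liftK.
(* Outside row [p], column [p] equals column [lift p q], so moving its weight to [q] preserves the
   product. *)
- apply/matrixP => i z; rewrite (ord1 z) !mxE -mul_tA_tw !mxE (bigD1_ord p) //=.
  rewrite !mxE Ap lift_eqF add0r [RHS]addrC.
  rewrite (eq_bigr (fun j => (map_mx intr (tA T)) (lift p i) (lift p j) * tw T (lift p j) 0
     + (j == q)%:R * ((tA T (lift p i) (lift p j))%:~R * tw T p 0))); last first.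
    by move=> j _; rewrite !mxE mulrDr mulrCA.
  rewrite big_split /=; congr (_ + _).
  rewrite (bigD1 q) //= eqxx mul1r big1 ?addr0 // => j /negbTE->.
  by rewrite mul0r.
- move=> j; rewrite mxE ltr_wpDr ?tw_gt0 // mulr_ge0 ?ler0n //.
  by rewrite ltW // tw_gt0.
exists G; split=> // [i j|j]; first by rewrite AE !mxE.
by rewrite wE mxE.
Qed.

(** Interchanges, and additions avoiding [q], lift directly. The other additions [C_ab] must also
    account for the weight of [p] hidden in that of [q]. *)
Lemma shadow_step p q T G G' : shadows p q T G -> forward_step G G' ->
  exists q' T', forward T T' /\ shadows p q' T' G'.
Proof.
move=> [Ap AG wG] [a [b [GG'|GG']]]; last first.
  case: GG' => ab AE _ wE.
  have [|T' TT'] := @interchange_step R _ (lift p a) (lift p b) T.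
    by rewrite lift_eqE.
  have [_ AE' _ wE'] := TT'.
  exists q, T'; split; first by apply: rt_step; exists (lift p a), (lift p b); right.
  have tpF : tperm (lift p a) (lift p b) p = p by rewrite tpermD ?lift_eqF.
  split=> [k|i j|j]; rewrite ?AE ?AE' ?wE ?wE' ?wG // !mxE ?AG.
    rewrite Ap; congr (Posz (nat_of_bool _) + _).
    by rewrite -[X in _ == X]tpF (inj_eq perm_inj).
  by rewrite (inj_tperm _ _ _ (@lift_inj _ p)).
have [ab] := GG'; rewrite subr_gt0 !wG => wab AE _.
have wE j : tw G' j 0 = if j == b then tw G b 0 - tw G a 0 else tw G j 0.
  by rewrite (column_addition_tw GG') mxE.
have {AE}AE i j : tA G' i j = if j == a then tA G i a + tA G i b else tA G i j.
  by rewrite AE mxE.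
have pF i : (p == lift p i) = false by rewrite eq_sym lift_eqF.
have simp := (lift_eqE, lift_eqF, pF, eqxx).
have ba : (b == a) = false by rewrite eq_sym (negbTE ab).
(* For [b = q] only [w_a < w_b + w_p] is known in [T], so the direct lift may be forbidden; [w_a] is
   compared with [w_p] instead. *)
have [eqb|bq] := eqVneq b q.
  subst q; rewrite (negbTE ab) mul0r addr0 eqxx mul1r in wab.
  have [wap|wpa|/eqP] := ltgtP (tw T (lift p a) 0) (tw T p 0); last first.
  - by rewrite (negbTE (tw_neq T _)) // lift_eqF.
  (* Adding column [a] to column [p] lowers [w_a] to [w_a - w_p < w_b], which permits adding [b] to
     [a]. Column [p] is then tied to [a]. *)
  - have [|T1 [TT1 A1 w1]] := @column_forward R _ p (lift p a) T _ wpa.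
      by rewrite pF.
    have [||T2 [T12 A2 w2]] := @column_forward R _ (lift p a) (lift p b) T1.
    + by rewrite lift_eqE.
    + by rewrite w1 !mxE !simp ?ba ltrBlDr.
    exists a, T2; split; first exact: rt_trans TT1 T12.
    split=> [k|i j|j].
    + by rewrite A2 !mxE !simp A1 !mxE !simp Ap; ring.
    + by rewrite AE A2 !mxE !simp A1 !mxE !simp !AG.
    + rewrite wE !wG w2 !mxE w1 !mxE !simp ?ba ?(negbTE ab).
      have [->|jb] := eqVneq j b; first by rewrite ba /=; ring.
      by case: eqVneq => [->|_] /=; ring.
  (* Column [p] serves as a copy of column [b]: outside row [p], adding it to column [a] has the
     same effect. *)
  - have [|T1 [TT1 A1 w1]] := @column_forward R _ (lift p a) p T _ wap.
      by rewrite lift_eqF.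
    exists b, T1; split=> //; split=> [k|i j|j].
    + by rewrite A1 !mxE !simp ba Ap.
    + by rewrite AE A1 !mxE !simp !AG Ap lift_eqF add0r.
    + rewrite wE !wG w1 !mxE !simp (negbTE ab).
      by case: eqVneq => [->|_] /=; ring.
(* For [a = q], column [b] is added to both [a] and [p] to keep them tied; [w_a + w_p < w_b] permits
   both. *)
have [eqa|aq] := eqVneq a q.
  subst q; rewrite (negbTE bq) mul0r addr0 eqxx mul1r in wab.
  have wp := tw_gt0 T p; have wa := tw_gt0 T (lift p a).
  have [||T1 [TT1 A1 w1]] := @column_forward R _ (lift p a) (lift p b) T.
  + by rewrite lift_eqE.
  + by lra.
  have [||T2 [T12 A2 w2]] := @column_forward R _ p (lift p b) T1.
  + by rewrite pF.
  + by rewrite w1 !mxE !simp; lra.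
  exists a, T2; split; first exact: rt_trans TT1 T12.
  split=> [k|i j|j].
  + by rewrite A2 !mxE !simp A1 !mxE !simp ba Ap; ring.
  + by rewrite AE A2 !mxE !simp A1 !mxE !simp !AG.
  + rewrite wE !wG w2 !mxE w1 !mxE !simp ?ba.
    by case: eqVneq => [->|_]; rewrite ?ba /=; ring.
rewrite (negbTE aq) (negbTE bq) !mul0r !addr0 in wab.
have [|T1 [TT1 A1 w1]] := @column_forward R _ (lift p a) (lift p b) T _ wab.
  by rewrite lift_eqE.
exists q, T1; split=> //; split=> [k|i j|j].
- by rewrite A1 !mxE !simp [q == a]eq_sym (negbTE aq) Ap.
- by rewrite AE A1 !mxE !simp !AG.
- rewrite wE !wG w1 !mxE !simp (negbTE aq) (negbTE bq).
  by case: eqVneq => [->|_]; rewrite ?(negbTE bq) /=; ring.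
Qed.

Lemma shadow_forward p q T G G' : shadows p q T G -> forward G G' ->
  exists q' T', forward T T' /\ shadows p q' T' G'.
Proof.
move=> sh GG'; elim: GG' q T sh => {G G'} [G G' GG'|G|G G1 G' _ IH1 _ IH2] q T sh.
- exact: shadow_step sh GG'.
- by exists q, T; split=> //; apply: rt_refl.
- have [q1 [T1 [TT1 sh1]]] := IH1 q T sh.
  have [q2 [T2 [T12 sh2]]] := IH2 q1 T1 sh1.
  by exists q2, T2; split=> //; apply: rt_trans TT1 T12.
Qed.

End Shadow.

(** * Induction on the dimension and passage to indexed sequences *)

Section Factorization.
Variable R : realType.

Lemma interchange_or_eq n (i j : 'I_n) (T : triple R n) :
  exists T', forward T T' /\ tA T' = xrow i j (tA T).
Proof.
have [->|ij] := eqVneq i j.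
  exists T; split; first exact: rt_refl.
  by apply/matrixP => k l; rewrite mxE tperm1 perm1.
have [T' TT'] := interchange_step T ij.
exists T'; split; last by case: TT'.
by apply: rt_step; exists i, j; right.
Qed.

Lemma forward_column_relation n r (T : triple R n) : (2 < n)%N ->
  exists T' p q, [/\ forward T T', p != q &
    forall k, tA T' k p = (k == r)%:Z + tA T' k q].
Proof.
move=> n2; pose c : 'cV[int]_n := invmx (tA T) *m delta_mx r 0.
have Ac : tA T *m c = delta_mx r 0 by rewrite mulKVmx // tA_unitmx.
have [T' [c' [TT' e [p [q [pq c'E]]]]]] := reaches_difference n2 Ac.
subst c'; exists T', p, q; split=> // k.
move/matrixP/(_ k 0): e; rewrite Ac mulmxBr -!colE !mxE eqxx andbT => /eqP.
by rewrite subr_eq => /eqP ->; case: (k == r).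
Qed.

Lemma factorization n (T : triple R n) :
  exists T', forward T T' /\ reduces (tA T') 1%:M.
Proof.
elim: n T => [|[|[|n]] IH] T.
- exists T; split; first exact: rt_refl.
  by rewrite [tA T]flatmx0 [1%:M]flatmx0; apply: rt1n_refl.
- exists T; split; first exact: rt_refl.
  suff -> : tA T = 1%:M by apply: rt1n_refl.
  apply/matrixP => i j; rewrite !ord1 mxE -det_mx11.
  have := tA_ge0 T 0 0; rewrite -det_mx11.
  by case: (tA_det T) => ->.
- case: (tA_det T) => dA.
    exists T; split; first exact: rt_refl.
    by apply: reduces2 => //; apply: tA_ge0.
  (* Determinant [-1]: exchanging the two rows makes it [1]. *)
  have [T' [TT' AE]] := interchange_or_eq 0 1 T.
  exists T'; split=> //; apply: reduces2; first exact: tA_ge0.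
  by rewrite AE xrowE det_mulmx det_perm odd_tperm dA.
have [T1 [p [q0 [TT1 pq Ap]]]] := forward_column_relation 0 T (isT : (2 < n.+3)%N).
(* This moves the unit vector in the column relation from row [0] to row [p]. *)
have [T2 [T12 A2]] := interchange_or_eq 0 p T1.
have [q q0E] : exists q, q0 = lift p q.
  by have [q ->|eqp] := unliftP p q0; [exists q | rewrite eqp eqxx in pq].
have Ap2 k : tA T2 k p = (k == p)%:Z + tA T2 k (lift p q).
  rewrite A2 !mxE Ap -q0E; congr (Posz (nat_of_bool _) + _).
  by rewrite -{2}(tpermR 0 p) (can2_eq (tpermK 0 p) (tpermK 0 p)) tpermR tpermL.
have [G sh] := shadow_exists Ap2.
have [G' [GG' red]] := IH G.
have [q' [T3 [T23 [Ap3 A3 _]]]] := shadow_forward sh GG'.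
exists T3; split.
  exact: rt_trans TT1 (rt_trans _ _ _ _ _ T12 T23).
by apply: (reduces_bordered red Ap3 A3) => k; apply: tA_ge0.
Qed.

Lemma reduces_row_subtraction n (A : 'M[int]_n) (T : triple R n) :
  reduces (tA T) A ->
  exists2 T', clos_refl_trans_1n _ (fun T T' => exists i j, row_subtraction j i T T') T T'
    & tA T' = A.
Proof.
move: {1 3}(tA T) (erefl (tA T)) => A0 A0E red.
elim: red T A0E => {A0 A} [A|A A' A'' [i [j [ij Aij A'E]]] _ IH] T AE.
  by exists T; [apply: rt1n_refl | rewrite AE].
rewrite AE in Aij A'E.
have [T1 TT1] := row_step ij Aij.
have [|T' T1T' A''E] := IH T1; first by case: TT1 => _ _ ->.
exists T' => //; apply: (Relation_Operators.rt1n_trans _ _ _ T1) => //.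
by exists i, j.
Qed.

Lemma sequence_of_clos (X : Type) (step : X -> X -> Prop) x y :
  clos_refl_trans_1n _ step x y ->
  exists (s : nat) (f : nat -> X), [/\ f 0%N = x, f s = y &
    forall k, (k < s)%N -> step (f k) (f k.+1)].
Proof.
elim=> {x y} [x|x y z xy _ [s [f [f0 fs fstep]]]].
  by exists 0%N, (fun=> x).
exists s.+1, (fun k => if k is k'.+1 then f k' else x); split=> // -[|k] //.
  by rewrite f0.
exact: fstep.
Qed.

End Factorization.

Theorem theorem2p1 (R : realType) (n : nat) (A : 'M[int]_n) (v : 'cV[R]_n)
    (hA : forall i j, 0 <= A i j) (hdet : \det A = 1 \/ \det A = -1)
    (hv : forall i, 0 < v i 0) (hind : rat_independent v)
    (hw : forall i, 0 < inv_apply A v i 0) :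
  exists (s t : nat) (T : nat -> triple R n),
    [/\ (s <= t)%N,
        [/\ tA (T 0%N) = A, tv (T 0%N) = v & tw (T 0%N) = inv_apply A v],
        forall k : nat, (k < s)%N ->
          exists i j : 'I_n, column_addition i j (T k) (T k.+1) \/
                             row_interchange i j (T k) (T k.+1),
        forall k : nat, (s <= k < t)%N ->
          exists i j : 'I_n, row_subtraction j i (T k) (T k.+1)
      & tA (T t) = 1%:M].
Proof.
pose T0 := Triple hA hdet hv hind (erefl (inv_apply A v)) hw.
have [T1 [forw red]] := factorization T0.
have [s [f [f0 fs fstep]]] := sequence_of_clos (clos_rt_rt1n _ _ _ _ forw).
have [T2 back A2] := reduces_row_subtraction red.
have [u [g [g0 gu gstep]]] := sequence_of_clos back.
(* The two sequences share the triple at index [s], where [f s = g 0]; hence [gE] includes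
   [k = s]. *)
exists s, (s + u)%N, (fun k => if (k <= s)%N then f k else g (k - s)%N).
have gE k : (s <= k)%N ->
    (if (k <= s)%N then f k else g (k - s)%N) = g (k - s)%N.
  move=> sk; case: leqP => // ks.
  have -> : k = s by apply/eqP; rewrite eqn_leq ks.
  by rewrite subnn fs g0.
split.
- exact: leq_addr.
- by rewrite /= f0.
- by move=> k ks; rewrite ks (ltnW ks); apply: fstep.
- move=> k /andP[sk kt]; rewrite !gE ?(leqW sk) // subSn //.
  by apply: gstep; rewrite ltn_subLR.
- by rewrite gE ?leq_addr // addKn gu.
Qed.
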